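(* Every subcubic graph $G$ has a packing $(1,1,2,2,3)$-coloring.
   Context: Graphs are finite and simple. A graph is subcubic if its maximum degree is at most $3$. The distance between two vertices is the number of edges of a shortest path between them (infinite if they lie in different components). For a non-decreasing sequence $S=(s_1,\ldots,s_k)$ of positive integers, a packing $S$-coloring of a graph $G$ is a partition of $V(G)$ into $V_1,\ldots,V_k$ (parts may be empty) such that for every $1\le i\le k$ and every pair of distinct vertices $u,v\in V_i$, the distance between $u$ and $v$ in $G$ is at least $s_i+1$. *)

(* Defs.v *)
From mathcomp Require Import all_boot.
Set Implicit Arguments.
Unset Strict Implicit.
Unset Printing Implicit Defensive.

(* A finite simple graph is a symmetric irreflexive relation e on a finType. *)

Definition degree (T : finType) (e : rel T) (x : T) : nat :=
  #|[set y | e x y]|.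

Definition max_degree (T : finType) (e : rel T) : nat :=
  \max_(x : T) degree e x.

Definition subcubic (T : finType) (e : rel T) : bool := max_degree e <= 3.

(* The n.-tuple p lists the vertices after x, so n counts edges. *)
Definition has_path (T : finType) (e : rel T) (x y : T) (n : nat) : bool :=
  [exists p : n.-tuple T, [&& path e x p, last x p == y & uniq (x :: p)]].

(* None stands for infinite distance. Since a path does not repeat vertices, it
   has fewer than #|T| edges, and find returns #|T| when there is no path. *)
Definition dist (T : finType) (e : rel T) (x y : T) : option nat :=
  let n := find (has_path e x y) (iota 0 #|T|) in
  if n < #|T| then Some n else None.

Definition dist_geq (d : option nat) (k : nat) : bool :=
  if d is Some n then k <= n else true.

Lemma has_path_lt (T : finType) (e : rel T) (x y : T) (n : nat) :
  has_path e x y n -> n < #|T|.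
Proof.
case/existsP=> p /and3P[_ _ /card_uniqP]; rewrite /= size_tuple => <-.
exact: max_card.
Qed.

Lemma distP (T : finType) (e : rel T) (x y : T) (n : nat) :
  dist e x y = Some n <->
  has_path e x y n /\ (forall m, has_path e x y m -> n <= m).
Proof.
have min m : has_path e x y m -> find (has_path e x y) (iota 0 #|T|) <= m.
  move=> hm; rewrite leqNgt; apply/negP=> /(before_find 0).
  by rewrite nth_iota ?hm // (has_path_lt hm).
have ex : find (has_path e x y) (iota 0 #|T|) < #|T| ->
    has_path e x y (find (has_path e x y) (iota 0 #|T|)).
  move=> lt; have := lt; rewrite -{2}(size_iota 0 #|T|) -has_find.
  by move/(nth_find 0); rewrite nth_iota.
rewrite /dist; split=> [|[hn nmin]]; first by case: ifP => // /ex h [<-].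
have lt := leq_ltn_trans (min _ hn) (has_path_lt hn).
by rewrite lt; congr Some; apply/eqP; rewrite eqn_leq min // nmin // ex.
Qed.

Lemma dist_connect (T : finType) (e : rel T) (x y : T) :
  dist e x y = None <-> ~~ connect e x y.
Proof.
split=> [dN|]; last first.
  case E: (dist e x y) => [n|] // /connectP[].
  have [/existsP[p /and3P[ep /eqP lp _]] _] := (distP e x y n).1 E.
  by exists p.
apply/negP=> /connectP[p0 ep0 def_y]; move: dN; rewrite {}def_y.
case/shortenP: ep0 => p ep up _ dN.
have hp : has_path e x (last x p) (size p).
  by apply/existsP; exists (in_tuple p); apply/and3P; split.
have ex : exists n, has_path e x (last x p) n by exists (size p).
case: (ex_minnP ex) => n hn nmin.
by have := (distP e x (last x p) n).2 (conj hn nmin); rewrite dN.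
Qed.

(* Unlike finset's partition, the parts are indexed and may be empty. *)
Definition indexed_partition (T : finType) (k : nat) (V : 'I_k -> {set T}) :
    Prop :=
  (forall x, exists i, x \in V i) /\
  (forall i j, i != j -> [disjoint V i & V j]).

(* Meant for non-decreasing sequences s of positive integers; parts are indexed
   from 0. *)
Definition packing_coloring (T : finType) (e : rel T) (s : seq nat)
    (V : 'I_(size s) -> {set T}) : Prop :=
  indexed_partition V /\
  forall (i : 'I_(size s)) (u v : T),
    u \in V i -> v \in V i -> u != v ->
    dist_geq (dist e u v) (nth 0 s i).+1.

(* Main.v *)
Require Import Defs.
From mathcomp Require Import all_boot.

(* Choose R with G - R bipartite, |R| minimum and, subject to that, as many
   vertices of R as possible having a neighbour in R. By the first minimality
   G[R] is a matching; call its vertices paired and the others unpaired. The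
   vertices outside R get the two classes of radius 1.

   Every unpaired v has a key: a neighbour u such that R - v + u is again
   bipartizing. By the choice of R, the only R-neighbour of a key of v is v, so
   at most two vertices of R are within distance 2 of v. Similar exchanges bound
   what lies near a pair. Now colour R by the two classes of radius 2 with as
   few blank vertices as possible, over all such R, and subject to that with as
   few paired blank ones as possible. Then no blank vertex is paired. The
   vertices of R near an unpaired blank vertex are all coloured, and since its
   blank can be moved to a key, the same holds near the key. This keeps blank
   vertices at distance at least 4, so they form the class of radius 3. *)

Set Implicit Arguments.
Unset Strict Implicit.
Unset Printing Implicit Defensive.

(** * Minimisers and neighbourhoods of size at most three *)

Lemma ex_minimizer (S : finType) (P : pred S) (f : S -> nat) :
  (exists s, P s) -> exists2 s, P s & forall t, P t -> f s <= f t.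
Proof. by case=> s0 Ps0; case: (arg_minnP f Ps0) => s Ps sP; exists s. Qed.

Section Subcubic.

Variables (T : finType) (e : rel T).
Hypotheses (e_sym : symmetric e) (e_irr : irreflexive e).
Hypothesis e_sub : subcubic e.

Implicit Types (R S : {set T}) (v u x y p q r : T).

Lemma adj_neq x y : e x y -> x != y.
Proof. by apply: contraTneq => ->; rewrite e_irr. Qed.

(** A fourth neighbour would exceed the maximum degree. Subcubicity enters the proof only through
    this lemma. *)
Lemma nbr_cases x a b c d :
  e x a -> e x b -> e x c -> a != b -> a != c -> b != c -> e x d ->
  [\/ d = a, d = b | d = c].
Proof.
move=> xa xb xc ab ac bc xd.
case: (eqVneq d a) => [|da]; first by constructor 1.
case: (eqVneq d b) => [|db]; first by constructor 2.
case: (eqVneq d c) => [|dc]; first by constructor 3.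
have: degree e x <= 3.
  by apply: leq_trans e_sub; rewrite /max_degree (leq_bigmax x).
suff: 4 <= degree e x by case: (degree e x) => [|[|[|[|?]]]].
have <-: #|[:: d; a; b; c]| = 4.
  by apply/card_uniqP; rewrite /= !inE !negb_or da db dc ab ac bc.
apply: subset_leq_card; apply/subsetP=> y; rewrite !inE.
by case/or4P=> /eqP->.
Qed.

(** * Bipartizing sets of minimum size *)

Definition proper R (c : T -> bool) :=
  forall x y, x \notin R -> y \notin R -> e x y -> c x != c y.

(** Colourings are taken as finite functions so that the property is boolean and can be minimised
    over. *)
Definition bipartizing R :=
  [exists c : {ffun T -> bool}, forall x, forall y,
     [==> x \notin R, y \notin R, e x y => c x != c y]].

Lemma bipartizingP R :
  reflect (exists c : T -> bool, proper R c) (bipartizing R).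
Proof.
apply: (iffP existsP) => [] [c cP].
  exists c => x y xR yR xy.
  by move/forallP: cP => /(_ x)/forallP/(_ y); rewrite xR yR xy.
exists (finfun c); apply/forallP=> x; apply/forallP=> y.
by rewrite !ffunE; apply/implyP=> ?; apply/implyP=> ?; apply/implyP; apply: cP.
Qed.

Definition min_bip R :=
  bipartizing R && [forall S, bipartizing S ==> (#|R| <= #|S|)].

Lemma min_bipP R S : min_bip R -> bipartizing S -> #|R| <= #|S|.
Proof. by case/andP=> _ /forallP/(_ S)/implyP. Qed.

Lemma min_bip_proper R : min_bip R -> exists c, proper R c.
Proof. by case/andP=> /bipartizingP. Qed.

(* Both colour classes meet the neighbourhood of v, as otherwise v could be
   taken out of R. *)
Lemma sees_both R c v beta :
  min_bip R -> proper R c -> v \in R ->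
  exists a, [/\ e v a, a \notin R & c a = beta].
Proof.
move=> minR cR vR.
case: (pickP [pred a | [&& e v a, a \notin R & c a == beta]]) => [a|none].
  by case/and3P=> va aR /eqP ca; exists a.
have /(min_bipP minR): bipartizing (R :\ v).
  apply/bipartizingP; exists (fun x => if x == v then beta else c x) => x y.
  rewrite !inE !negb_and !negbK => xR yR xy.
  have nb a : e v a -> a \notin R -> beta != c a.
    by move=> va aR; have:= none a; rewrite /= va aR /= eq_sym => ->.
  case: (eqVneq x v) xR => [xv _|_ /= xR].
    case: (eqVneq y v) yR => [yv|_ /= yR]; first by rewrite xv yv e_irr in xy.
    by apply: nb => //; rewrite -xv.
  case: (eqVneq y v) yR => [yv _|_ /= yR]; last exact: cR.
  by rewrite eq_sym; apply: nb => //; rewrite -yv e_sym.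
by rewrite (cardsD1 v R) vR ltnn.
Qed.

(** By [sees_both], [v] has two neighbours outside [R], which leaves room for only one inside. *)
Lemma min_bip_matching R v x y :
  min_bip R -> v \in R -> x \in R -> y \in R -> e v x -> e v y -> x = y.
Proof.
move=> minR vR xR yR vx vy; have [c cR] := min_bip_proper minR.
have [a [va aR ca]] := sees_both true minR cR vR.
have [b [vb bR cb]] := sees_both false minR cR vR.
have ab : a != b by apply: contraTneq ca => ->; rewrite cb.
have neqR p q : p \notin R -> q \in R -> p != q.
  by move=> pR qR; apply: contraNneq pR => ->.
have [] := nbr_cases va vb vx ab (neqR _ _ aR xR) (neqR _ _ bR xR) vy.
- by move=> ya; rewrite -ya yR in aR.
- by move=> yb; rewrite -yb yR in bR.
by [].
Qed.

(** * Exchanging one vertex of a bipartizing set *)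

Definition swap R v u := u |: (R :\ v).

Lemma in_swap R v u x : (x \in swap R v u) = (x == u) || (x != v) && (x \in R).
Proof. by rewrite !inE. Qed.

Lemma card_swap R v u : v \in R -> u \notin R -> #|swap R v u| = #|R|.
Proof.
move=> vR uR; rewrite cardsU1 !inE (negPf uR) andbF /= add1n.
by rewrite (cardsD1 v R) vR.
Qed.

Lemma swap_min_bip R v u :
  min_bip R -> v \in R -> u \notin R -> bipartizing (swap R v u) ->
  min_bip (swap R v u).
Proof.
move=> minR vR uR ok; rewrite /min_bip ok; apply/forallP=> S; apply/implyP.
by rewrite card_swap //; apply: min_bipP.
Qed.

(** With [u] removed, every remaining neighbour of [v] has colour [beta], so [v] can take the other
    colour. *)
Lemma swap_bip R c v u beta :
  proper R c ->
  (forall a, e v a -> a \notin R -> a != u -> c a = beta) ->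
  bipartizing (swap R v u).
Proof.
move=> cR vP; apply/bipartizingP.
exists (fun x => if x == v then ~~ beta else c x) => x y.
rewrite !in_swap !negb_or !negb_and !negbK => /andP[xu xR] /andP[yu yR] xy.
case: (eqVneq x v) xR => [xv _|_ /= xR].
  case: (eqVneq y v) yR => [yv|_ /= yR]; first by rewrite xv yv e_irr in xy.
  by rewrite (vP y) // -?xv //; case: (beta).
case: (eqVneq y v) yR => [yv _|_ /= yR]; last exact: cR.
by rewrite (vP x) // -?yv 1?e_sym //; case: (beta).
Qed.

Lemma recolour_isolated R c p beta :
  proper R c -> (forall x, e p x -> x \in R) ->
  proper R (fun x => if x == p then beta else c x).
Proof.
move=> cR pP x y xR yR xy.
case: (eqVneq x p) => [xp|_]; first by case/negP: yR; apply: pP; rewrite -xp.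
case: (eqVneq y p) => [yp|_]; last exact: cR.
by case/negP: xR; apply: pP; rewrite -yp e_sym.
Qed.

(** * Paired vertices and optimal sets *)

Definition paired R := [set x in R | [exists y in R, e x y]].

Lemma pairedP R x :
  reflect (x \in R /\ exists2 y, y \in R & e x y) (x \in paired R).
Proof. by rewrite inE; apply: (iffP andP) => [] [xR /exists_inP]. Qed.

Lemma unpaired_nbr R v x :
  v \in R -> v \notin paired R -> e v x -> x \notin R.
Proof.
by move=> vR nv vx; apply: contra nv => xR; apply/pairedP; split=> //; exists x.
Qed.

Definition optimal R :=
  min_bip R && [forall S, min_bip S ==> (#|paired S| <= #|paired R|)].

Lemma optimal_min R : optimal R -> min_bip R.
Proof. by case/andP. Qed.

Lemma optimalP R S : optimal R -> min_bip S -> #|paired S| <= #|paired R|.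
Proof. by case/andP=> _ /forallP/(_ S)/implyP. Qed.

Lemma optimal_eq R S :
  optimal R -> min_bip S -> #|paired R| <= #|paired S| -> optimal S.
Proof.
move=> optR minS le; rewrite /optimal minS; apply/forallP=> S'; apply/implyP.
by move=> minS'; apply: leq_trans le; apply: optimalP.
Qed.

Lemma optimal_exists : exists R, optimal R.
Proof.
have [|R0 okR0 minR0] := @ex_minimizer _ bipartizing (fun R => #|R|).
  by exists setT; apply/bipartizingP; exists xpredT => x y; rewrite inE.
(* The number of paired vertices is maximised by minimising its difference from [#|T|]; it never
   exceeds [#|T|], so nothing is truncated. *)
have [|R minR maxR] := @ex_minimizer _ min_bip (fun R => #|T| - #|paired R|).
  exists R0; rewrite /min_bip okR0; apply/forallP=> S; apply/implyP.
  exact: minR0.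
exists R; rewrite /optimal minR; apply/forallP=> S; apply/implyP=> /maxR.
by rewrite leq_sub2lE // max_card.
Qed.

(** * Exchanges at an unpaired vertex *)

Section Unpaired.

Variables (R : {set T}) (v : T).
Hypotheses (optR : optimal R) (vR : v \in R) (v_unp : v \notin paired R).

Let nbr_v x : e v x -> x \notin R := unpaired_nbr vR v_unp.

(** No edge inside [R] ends at [v], so removing [v] breaks no pair. *)
Lemma unpaired_swap_sub u : v != u -> paired R \subset paired (swap R v u).
Proof.
move=> vu; apply/subsetP=> x /pairedP[xR [y yR xy]].
have nv z w : z \in R -> w \in R -> e z w -> z != v.
  by move=> zR wR zw; apply: contraTneq zw => ->; apply: contraL wR => /nbr_v.
apply/pairedP; rewrite in_swap xR (nv x y) // orbT; split=> //.
by exists y; rewrite // in_swap yR (nv y x) ?orbT // e_sym.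
Qed.

Lemma unpaired_swap_optimal u :
  e v u -> bipartizing (swap R v u) -> optimal (swap R v u).
Proof.
move=> vu ok; apply: (optimal_eq optR).
  by apply: swap_min_bip => //; [apply: optimal_min | apply: nbr_v].
by apply: subset_leq_card; apply: unpaired_swap_sub; apply: adj_neq.
Qed.

(** Otherwise the exchange keeps all paired vertices and makes [u] paired with [r], against
    optimality. *)
Lemma unpaired_key_nbr u r :
  e v u -> bipartizing (swap R v u) -> r \in R -> e u r -> r = v.
Proof.
move=> vu ok rR ur; apply/eqP; apply: contraT => rv.
have minS : min_bip (swap R v u).
  by apply: swap_min_bip => //; [apply: optimal_min | apply: nbr_v].
have:= optimalP optR minS; rewrite leqNgt => /negP[].
apply: proper_card; apply/properP; split.
  by apply: unpaired_swap_sub; apply: adj_neq.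
exists u; last by apply/negP=> /pairedP[]; rewrite (negPf (nbr_v vu)).
apply/pairedP; rewrite in_swap eqxx; split=> //; exists r => //.
by rewrite in_swap rv rR orbT.
Qed.

Lemma unpaired_swap_unpaired u :
  e v u -> bipartizing (swap R v u) -> u \notin paired (swap R v u).
Proof.
move=> vu ok; apply/negP=> /pairedP[_ [r]]; rewrite in_swap.
case/orP=> [/eqP->|/andP[rv rR]] ur; first by rewrite e_irr in ur.
by rewrite (unpaired_key_nbr vu ok rR ur) eqxx in rv.
Qed.

(** Both colours occur among the at most three neighbours of [v], so one of them occurs exactly
    once; its bearer is a key. *)
Lemma unpaired_key c :
  proper R c -> exists b, [/\ e v b, bipartizing (swap R v b) &
    forall x, e v x -> x != b -> c x = ~~ c b].
Proof.
move=> cR; have minR := optimal_min optR.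
have key b : e v b -> (forall x, e v x -> x != b -> c x = ~~ c b) ->
    exists b, [/\ e v b, bipartizing (swap R v b) &
      forall x, e v x -> x != b -> c x = ~~ c b].
  move=> vb bP; exists b; split=> //.
  by apply: (swap_bip cR) => x vx _; apply: bP vx.
have [a [va aR ca]] := sees_both true minR cR vR.
have [b [vb bR cb]] := sees_both false minR cR vR.
case: (pickP [pred x | [&& e v x, x != b & c x == false]]) => [w|none].
  case/and3P=> vw wb /eqP cw; apply: (key a) => // x vx xa; rewrite ca.
  have ab : a != b by apply: contraTneq ca => ->; rewrite cb.
  have aw : a != w by apply: contraTneq ca => ->; rewrite cw.
  rewrite eq_sym in wb.
  by have [xa'||] := nbr_cases va vb vw ab aw wb vx; [rewrite xa' eqxx in xa|move->..].
apply: (key b) => // x vx xb; have:= none x; rewrite /= vx xb /= cb.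
by case: (c x).
Qed.

(* An isolated vertex p of G - R may take either colour, so it can be given the
   colour of the third neighbour of v. *)
Lemma unpaired_isolated_key p u :
  e v p -> e v u -> u != p -> (forall x, e p x -> x \in R) ->
  bipartizing (swap R v u).
Proof.
move=> vp vu up pP; have [c cR] := min_bip_proper (optimal_min optR).
case: (pickP [pred w | [&& e v w, w != p & w != u]]) => [w|none].
  case/and3P=> vw wp wu.
  apply: (swap_bip (recolour_isolated (c w) cR pP) (beta := c w)) => a va _ au.
  rewrite eq_sym in wp; rewrite eq_sym in wu.
  have [au'|->|->] := nbr_cases vu vp vw up wu wp va.
  - by rewrite au' eqxx in au.
  - by rewrite eqxx.
  by rewrite eq_sym (negPf wp).
apply: (swap_bip cR (beta := c p)) => a va _ au.
case: (eqVneq a p) => [->//|ap].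
by have:= none a; rewrite /= va ap au.
Qed.

(** If the three middle vertices are distinct, one of them is a key, beyond which only [v] lies in
    [R]. *)
Lemma unpaired_near3 p1 p2 p3 r1 r2 r3 :
  e v p1 -> e p1 r1 -> e v p2 -> e p2 r2 -> e v p3 -> e p3 r3 ->
  r1 \in R -> r2 \in R -> r3 \in R -> r1 != v -> r2 != v -> r3 != v ->
  r1 != r2 -> r1 != r3 -> r2 != r3 -> False.
Proof.
(* If [r] and [s] lie beyond the same [p], then [p] is isolated outside [R], every other neighbour
   of [v] is a key, and [t] has no place. *)
have two p r s q t : e v p -> e p r -> e p s -> e v q -> e q t ->
    r \in R -> s \in R -> t \in R -> r != v -> s != v -> t != v ->
    r != s -> r != t -> s != t -> False.
  move=> vp pr ps vq qt rR sR tR rv sv tv rs rt st.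
  have pv : e p v by rewrite e_sym.
  have pP x : e p x -> [\/ x = v, x = r | x = s].
    by move=> px; apply: (nbr_cases pv pr ps _ _ rs px); rewrite eq_sym.
  have qp : q != p.
    apply: contraTneq qt => ->; apply/negP=> /pP[] tE.
    - by rewrite tE eqxx in tv.
    - by rewrite tE eqxx in rt.
    - by rewrite tE eqxx in st.
  have key : bipartizing (swap R v q).
    by apply: (unpaired_isolated_key vp vq qp) => x /pP[] ->.
  by rewrite (unpaired_key_nbr vq key tR qt) eqxx in tv.
move=> v1 pr1 v2 pr2 v3 pr3 R1 R2 R3 n1 n2 n3 r12 r13 r23.
case: (eqVneq p1 p2) => [p12|p12].
  by apply: (two p1 r1 r2 p3 r3) => //; rewrite p12.
case: (eqVneq p1 p3) => [p13|p13].
  by apply: (two p1 r1 r3 p2 r2) => //; rewrite ?p13 // eq_sym.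
case: (eqVneq p2 p3) => [p23|p23].
  by apply: (two p2 r2 r3 p1 r1) => //; rewrite ?p23 // eq_sym.
have [c cR] := min_bip_proper (optimal_min optR).
have [b [vb key _]] := unpaired_key cR.
have no p r : e p r -> r \in R -> r != v -> b <> p.
  move=> pr rR /eqP rv bp; apply: rv; apply: (unpaired_key_nbr vb key rR).
  by rewrite bp.
have [] := nbr_cases v1 v2 v3 p12 p13 p23 vb.
- exact: no pr1 R1 n1.
- exact: no pr2 R2 n2.
exact: no pr3 R3 n3.
Qed.

End Unpaired.

(** * Exchanges at a paired vertex *)

Section Paired.

Variables (R : {set T}) (v y : T).
Hypotheses (optR : optimal R) (vR : v \in R) (yR : y \in R) (vy : e v y).

Let minR : min_bip R := optimal_min optR.

Let notinR_neq p q : p \notin R -> q \in R -> p != q.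
Proof. by move=> pR qR; apply: contraNneq pR => ->. Qed.

Lemma paired_nbrs c a :
  proper R c -> e v a -> a \notin R ->
  exists b, [/\ e v b, b \notin R, c b = ~~ c a &
    forall x, e v x -> [\/ x = a, x = b | x = y]].
Proof.
move=> cR va aR; have [b [vb bR cb]] := sees_both (~~ c a) minR cR vR.
exists b; split=> // x; apply: nbr_cases => //; try exact: notinR_neq.
by apply: contra_eqN cb => /eqP ->; case: (c b).
Qed.

(** Once [a] has joined the set, [v] has a single neighbour left outside and can be coloured against
    it. *)
Lemma paired_swap_min a : e v a -> a \notin R -> min_bip (swap R v a).
Proof.
move=> va aR; apply: swap_min_bip => //.
have [c cR] := min_bip_proper minR; have [b [vb bR _ vP]] := paired_nbrs cR va aR.
apply: (swap_bip cR (beta := c b)) => x /vP[->|->|->] //.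
  by rewrite eqxx.
by rewrite yR.
Qed.

(** Otherwise all neighbours of [a] are in [R], and [a] can be recoloured like the other outside
    neighbour of [v]; then [v] sees only one colour. *)
Lemma paired_nbr_unique a r s :
  e v a -> a \notin R -> e a r -> r \in R -> r != v ->
  e a s -> s \in R -> s != v -> r = s.
Proof.
move=> va aR ar rR rv as_ sR sv; apply/eqP; apply: contraT => rs.
have [c cR] := min_bip_proper minR; have [b [vb bR cb vP]] := paired_nbrs cR va aR.
have av : e a v by rewrite e_sym.
have aP x : e a x -> x \in R.
  have va' : v != r by rewrite eq_sym.
  have vs' : v != s by rewrite eq_sym.
  by move=> ax; have [->|->|->] := nbr_cases av ar as_ va' vs' rs ax.
have [d [vd dR]] := sees_both (~~ c b) minR (recolour_isolated (c b) cR aP) vR.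
case: (eqVneq d a) => [_|da]; first by case: (c b).
case: (vP d vd) => [da'|->|dy]; first by rewrite da' eqxx in da.
  by case: (c b).
by rewrite dy yR in dR.
Qed.

(** After exchanging [v] for [a], a paired [r] would be adjacent both to [a] and to its partner, so
    the new set would not induce a matching. *)
Lemma paired_nbr_unpaired a r :
  e v a -> a \notin R -> e a r -> r \in R -> r != v -> r != y ->
  r \notin paired R.
Proof.
move=> va aR ar rR rv ry; apply/negP=> /pairedP[_ [z zR rz]].
have minS := paired_swap_min va aR.
have zv : z != v.
  apply: contraTneq rz => ->; apply/negP=> rv'; case/negP: ry.
  by apply/eqP; apply: (min_bip_matching minR vR) => //; rewrite e_sym.
have az : a = z.
  apply: (min_bip_matching minS (v := r)) => //; rewrite ?in_swap.
  - by rewrite rv rR orbT.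
  - by rewrite eqxx.
  - by rewrite zv zR orbT.
  - by rewrite e_sym.
by rewrite az zR in aR.
Qed.

Lemma paired_swap_optimal a r :
  e v a -> a \notin R -> e a r -> r \in R -> r != v -> r != y ->
  optimal (swap R v a).
Proof.
move=> va aR ar rR rv ry; apply: (optimal_eq optR); first exact: paired_swap_min.
have rP := paired_nbr_unpaired va aR ar rR rv ry.
have vII : v \in paired R by apply/pairedP; split=> //; exists y.
have yII : y \in paired R.
  by apply/pairedP; split=> //; exists v; rewrite // e_sym.
have yv : y != v by rewrite eq_sym adj_neq.
have rS : r \in swap R v a by rewrite in_swap rv rR orbT.
have aS : a \in swap R v a by rewrite in_swap eqxx.
(* The pair of [v] and [y] is lost and the pair of [a] and [r] is gained; the vertices of [D] stay
   paired. *)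
set D := paired R :\ v :\ y.
have <-: #|a |: (r |: D)| = #|paired R|.
  have aD : a \notin r |: D.
    by rewrite !inE (negPf aR) !andbF orbF eq_sym; apply: contraNneq aR => <-.
  have rD : r \notin D by rewrite !in_setD1 (negPf rP) !andbF.
  rewrite cardsU1 aD cardsU1 rD (cardsD1 v (paired R)) vII.
  by rewrite (cardsD1 y (paired R :\ v)) in_setD1 yv yII.
apply: subset_leq_card; apply/subsetP=> x; rewrite !in_setU1 !in_setD1.
case/or3P=> [/eqP->|/eqP->|/and3P[xy xv /pairedP[xR [z zR xz]]]].
- by apply/pairedP; split=> //; exists r.
- by apply/pairedP; split=> //; exists a; rewrite // e_sym.
apply/pairedP; rewrite in_swap xv xR orbT; split=> //; exists z => //.
rewrite in_swap zR andbT; apply/orP; right.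
apply: contraTneq xz => ->; apply: contra xy => xv'; apply/eqP.
by apply: (min_bip_matching minR vR) => //; rewrite e_sym.
Qed.

End Paired.

(* If v has R-vertices r, s beyond both its neighbours a, b, moving y to a'
   would leave v unpaired with R-vertices beyond all three neighbours. *)
Lemma paired_near R v y a b r s a' t :
  optimal R -> v \in R -> y \in R -> e v y ->
  e v a -> a \notin R -> e v b -> b \notin R -> a != b ->
  e a r -> r \in R -> r != v -> r != y ->
  e b s -> s \in R -> s != v -> s != y ->
  e y a' -> a' \notin R -> e a' t -> t \in R -> t != y -> t = v.
Proof.
move=> optR vR yR vy va aR vb bR ab ar rR rv ry bs sR sv sy ya' a'R a't tR ty.
apply/eqP; apply: contraT => tv.
have yv : e y v by rewrite e_sym.
have optS := paired_swap_optimal optR yR vR yv ya' a'R a't tR ty tv.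
set S := swap R y a' in optS *.
have inS x : x \in R -> x != y -> x \in S.
  by move=> xR xy; rewrite in_swap xR xy orbT.
have vy_neq := adj_neq vy.
have vS : v \in S := inS v vR vy_neq.
have yS : y \notin S by rewrite in_swap eqxx orbF; apply: contraNneq a'R => <-.
have notR p q : p \notin R -> q \in R -> p != q.
  by move=> pR qR; apply: contraNneq pR => ->.
have v_nbr : forall x, e v x -> [\/ x = a, x = b | x = y].
  by move=> x; apply: nbr_cases => //; apply: notR.
have only_v x z : e v x -> x \notin R -> e x y -> e x z -> z \in R ->
    z != v -> z != y -> False.
  move=> vx xR xy xz zR zv zy; case/negP: zy; apply/eqP.
  by apply: (paired_nbr_unique optR vR yR vy vx xR) => //; rewrite eq_sym.
(* Otherwise [a'] would have both [y] and [t] as neighbours in [R] besides [v]. *)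
have va' : ~~ e v a'.
  apply/negP=> va'; apply: (only_v a' t) => //; by rewrite e_sym.
have v_unp : v \notin paired S.
  apply/negP=> /pairedP[_ [x xS vx]].
  case: (v_nbr x vx) xS => ->; rewrite ?(negPf yS) // in_swap.
    by rewrite (negPf aR) andbF orbF => /eqP aa'; rewrite -aa' va in va'.
  by rewrite (negPf bR) andbF orbF => /eqP bb'; rewrite -bb' vb in va'.
have [c cS] := min_bip_proper (optimal_min optS).
have [k [vk key _]] := unpaired_key optS vS cS.
have keyP z := unpaired_key_nbr optS vS v_unp vk key (r := z).
case: (v_nbr k vk) keyP => -> keyP.
- by rewrite (keyP r (inS r rR ry) ar) eqxx in rv.
- by rewrite (keyP s (inS s sR sy) bs) eqxx in sv.
(* If the key is [y], its neighbour [a'], now in [S], would have to be [v]. *)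
by have a'v := keyP a' (setU11 _ _) ya'; rewrite a'v vR in a'R.
Qed.

(** * Vertices at distance one or two *)

Definition near x y := (x != y) && (e x y || [exists p, e x p && e p y]).

Lemma nearP x y :
  reflect (x != y /\ (e x y \/ exists2 p, e x p & e p y)) (near x y).
Proof.
apply: (iffP andP) => [] [xy exy]; split=> //.
  by case/orP: exy => [|/exists_inP]; [left|right].
by case: exy => [->//|exy]; apply/orP; right; apply/exists_inP.
Qed.

Lemma near_sym x y : near x y = near y x.
Proof.
have sub a b : near a b -> near b a.
  case/nearP=> ab h; apply/nearP; rewrite eq_sym e_sym; split=> //.
  by case: h => [|[p ap pb]]; [left|right; exists p; rewrite e_sym].
by apply/idP/idP; apply: sub.
Qed.

Lemma near_neq x y : near x y -> x != y.
Proof. by case/andP. Qed.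

Lemma near_mid x y p : x != y -> e x p -> e p y -> near x y.
Proof. by move=> xy xp py; apply/nearP; split=> //; right; exists p. Qed.

Lemma near_unpaired R v x :
  v \in R -> v \notin paired R -> x \in R -> near v x ->
  exists2 p, e v p & e p x.
Proof.
move=> vR nv xR /nearP[_ [vx|//]].
by have:= unpaired_nbr vR nv vx; rewrite xR.
Qed.

(** Since [R] induces a matching, [x] is not adjacent to [v], and a middle vertex in [R] would have
    two neighbours in [R]. *)
Lemma near_paired R v y x :
  optimal R -> v \in R -> y \in R -> e v y -> x \in R -> near v x -> x != y ->
  exists p, [/\ e v p, p \notin R & e p x].
Proof.
move=> /optimal_min minR vR yR vy xR /nearP[vx h] xy.
case: h => [vx'|[p vp px]]; first by rewrite (min_bip_matching minR vR xR yR) ?eqxx in xy.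
exists p; split=> //; apply/negP=> pR; case/negP: vx; apply/eqP.
by apply: (min_bip_matching minR pR) => //; rewrite e_sym.
Qed.

(** By [paired_nbr_unique] the three vertices lie beyond distinct neighbours of [v], all different
    from [y]: four neighbours. *)
Lemma paired_near3 R v y x1 x2 x3 :
  optimal R -> v \in R -> y \in R -> e v y ->
  x1 \in R -> x2 \in R -> x3 \in R -> near v x1 -> near v x2 -> near v x3 ->
  x1 != y -> x2 != y -> x3 != y -> x1 != x2 -> x1 != x3 -> x2 != x3 -> False.
Proof.
move=> optR vR yR vy R1 R2 R3 n1 n2 n3 y1 y2 y3 x12 x13 x23.
have [p1 [vp1 pR1 px1]] := near_paired optR vR yR vy R1 n1 y1.
have [p2 [vp2 pR2 px2]] := near_paired optR vR yR vy R2 n2 y2.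
have [p3 [vp3 pR3 px3]] := near_paired optR vR yR vy R3 n3 y3.
have neq p q x x' : e v p -> p \notin R -> e p x -> e q x' -> x \in R ->
    x' \in R -> near v x -> near v x' -> x != x' -> p != q.
  move=> vp pR px qx' xR x'R nx nx' xx'; apply: contraNneq xx' => pq.
  apply/eqP; apply: (paired_nbr_unique optR vR yR vy vp pR) => //.
  - by rewrite eq_sym near_neq.
  - by rewrite pq.
  - by rewrite eq_sym near_neq.
have p12 := neq _ p2 _ x2 vp1 pR1 px1 px2 R1 R2 n1 n2 x12.
have p13 := neq _ p3 _ x3 vp1 pR1 px1 px3 R1 R3 n1 n3 x13.
have p23 := neq _ p3 _ x3 vp2 pR2 px2 px3 R2 R3 n2 n3 x23.
have notR p : p \notin R -> y <> p by move=> pR yp; rewrite -yp yR in pR.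
by have [] := nbr_cases vp1 vp2 vp3 p12 p13 p23 vy; apply: notR.
Qed.

(** * Partial colourings of [R] with fewest blank vertices *)

(* Some true and Some false are the two classes of radius 2; None marks the
   vertices left for the class of radius 3. *)
Definition valid R (d : T -> option bool) :=
  forall x y, x \in R -> y \in R -> near x y -> d x = d y -> d x = None.

Definition validb R (d : T -> option bool) :=
  [forall x, forall y,
    [==> x \in R, y \in R, near x y, d x == d y => d x == None]].

Lemma validP R d : reflect (valid R d) (validb R d).
Proof.
apply: (iffP idP) => [/forallP h x y xR yR xy dxy|h].
  by move/forallP: (h x) => /(_ y); rewrite xR yR xy dxy eqxx => /eqP.
apply/forallP=> x; apply/forallP=> y; apply/implyP=> xR; apply/implyP=> yR.
by apply/implyP=> xy; apply/implyP=> /eqP dxy; apply/eqP; apply: h dxy.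
Qed.

Definition recolour (d : T -> option bool) z o x := if x == z then o else d x.

Lemma valid_recolour R d z o :
  valid R d -> (forall x, x \in R -> near z x -> d x = o -> o = None) ->
  valid R (recolour d z o).
Proof.
move=> dR zP x y xR yR xy; rewrite /recolour.
case: eqVneq xy => [->|xz] xy; case: eqVneq xy => [->|yz] xy.
- by case/andP: xy; rewrite eqxx.
- by move=> oE; apply: (zP y).
- by move=> oE; rewrite oE; apply: (zP x); rewrite // near_sym.
exact: dR.
Qed.

Definition blank R (d : T -> option bool) := [set x in R | d x == None].

Lemma blankP R d x : reflect (x \in R /\ d x = None) (x \in blank R d).
Proof. by rewrite inE; apply: (iffP andP) => [] [-> /eqP]. Qed.

(** The comparison runs over all optimal sets, so that exchanges in [R] may also be used to
    compete. *)
Definition least_blank R d :=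
  [/\ optimal R, valid R d &
      forall S f, optimal S -> valid S f -> #|blank R d| <= #|blank S f|].

Lemma least_blank_exists : exists R d,
  least_blank R d /\ forall S f, least_blank S f ->
    #|blank R d :&: paired R| <= #|blank S f :&: paired S|.
Proof.
(* Pairing the set with a finite function gives a finite type, over which the two criteria are
   minimised in turn. *)
pose state := ({set T} * {ffun T -> option bool})%type.
pose good (s : state) := optimal s.1 && validb s.1 s.2.
have goodP R f : optimal R -> valid R f -> good (R, finfun f).
  move=> optR fR; rewrite /good /= optR; apply/validP=> x y xR yR xy.
  by rewrite !ffunE; apply: fR.
have blankE R f : blank R (finfun f) = blank R f.
  by apply/setP=> x; rewrite !inE ffunE.
have [|s0 good0 min0] := @ex_minimizer _ good (fun s => #|blank s.1 s.2|).
  have [R optR] := optimal_exists; exists (R, finfun (fun=> None)).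
  by apply: goodP.
pose least (s : state) := good s && (#|blank s.1 s.2| <= #|blank s0.1 s0.2|).
have [|[R d]] := @ex_minimizer _ least (fun s => #|blank s.1 s.2 :&: paired s.1|).
  by exists s0; rewrite /least good0 leqnn.
case/andP=> /andP[/= optR /validP dR] le min1.
have leastRd : least_blank R d.
  split=> // S f optS fS; apply: leq_trans le _.
  by have:= min0 _ (goodP S f optS fS); rewrite blankE.
exists R, d; split=> // S f [optS fS minS].
have:= min1 (S, finfun f); rewrite /= blankE; apply.
rewrite /least goodP //= blankE; apply: leq_trans (minS _ _ optR dR) le.
Qed.

Lemma least_blank_eq R d S f :
  least_blank R d -> optimal S -> valid S f -> #|blank S f| = #|blank R d| ->
  least_blank S f.
Proof. by case=> _ _ minR optS fS eqRS; split=> //; rewrite eqRS. Qed.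

(** Otherwise [z] could receive the colour [beta], leaving fewer blank vertices. *)
Lemma blank_sees R d z beta :
  least_blank R d -> z \in blank R d ->
  exists x, [/\ x \in R, near z x & d x = Some beta].
Proof.
case=> optR dR minR zB; have [zR dz] := blankP _ _ _ zB.
case: (pickP [pred x | [&& x \in R, near z x & d x == Some beta]]) => [x|none].
  by case/and3P=> xR zx /eqP dx; exists x.
have /(minR R _ optR): valid R (recolour d z (Some beta)).
  apply: valid_recolour => // x xR zx dx.
  by have:= none x; rewrite /= xR zx dx eqxx.
suff ->: blank R (recolour d z (Some beta)) = blank R d :\ z.
  by rewrite (cardsD1 z (blank R d)) zB ltnn.
by apply/setP=> x; rewrite !inE /recolour; case: (eqVneq x z) => //=; rewrite andbF.
Qed.

(** * Distances between unpaired blank vertices *)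

(** With one vertex of each colour near [z], a blank one would be a third, which [unpaired_near3]
    forbids. *)
Lemma blank_unpaired_near R d z x :
  least_blank R d -> z \in blank R d -> z \notin paired R -> x \in blank R d ->
  ~~ near z x.
Proof.
move=> lRd zB zU /blankP[xR dx]; have [zR dz] := blankP _ _ _ zB.
have [s [sR zs ds]] := blank_sees true lRd zB.
have [t [tR zt dt]] := blank_sees false lRd zB.
apply/negP=> zx; have [optR _ _] := lRd.
have [p1 vp1 ps] := near_unpaired zR zU sR zs.
have [p2 vp2 pt] := near_unpaired zR zU tR zt.
have [p3 vp3 px] := near_unpaired zR zU xR zx.
apply: (unpaired_near3 optR zR zU vp1 ps vp2 pt vp3 px) => //.
- by rewrite eq_sym near_neq.
- by rewrite eq_sym near_neq.
- by rewrite eq_sym near_neq.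
- by apply: contra_eqN ds => /eqP->; rewrite dt.
- by apply: contra_eqN ds => /eqP->; rewrite dx.
- by apply: contra_eqN dt => /eqP->; rewrite dx.
Qed.

(* The blank of z can be moved to u, so blank_unpaired_near applies at u. *)
Lemma blank_key_near R d z u x :
  least_blank R d -> z \in blank R d -> z \notin paired R -> e z u ->
  bipartizing (swap R z u) -> x \in blank R d -> x != z -> ~~ near u x.
Proof.
move=> lRd zB zU zu key xB xz; have [zR dz] := blankP _ _ _ zB.
have [optR dR _] := lRd; have uR := unpaired_nbr zR zU zu.
have blankE : blank (swap R z u) (recolour d u None) = swap (blank R d) z u.
  apply/setP=> w; rewrite inE !in_swap inE /recolour.
  by case: eqVneq => //= _; rewrite andbA.
apply: (blank_unpaired_near (R := swap R z u) (d := recolour d u None)).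
- apply: (least_blank_eq lRd); first exact: unpaired_swap_optimal.
    move=> a b; rewrite !in_swap /recolour.
    case: (eqVneq a u) => //= au /andP[_ aR].
    case: (eqVneq b u) => //= bu /andP[_ bR]; exact: dR.
  by rewrite blankE card_swap // inE negb_and uR.
- by rewrite blankE in_swap eqxx.
- exact: unpaired_swap_unpaired.
by rewrite blankE in_swap xz xB orbT.
Qed.

(** Otherwise the two coloured vertices near [z] lie beyond neither [p] nor a key, hence both beyond
    the third neighbour of [z]. That neighbour is then isolated outside [R], which makes [p] a
    key. *)
Lemma blank_nonkey_nbr R d z p :
  least_blank R d -> z \in blank R d -> z \notin paired R -> e z p ->
  ~~ bipartizing (swap R z p) -> exists r, [/\ r \in R, r != z & e p r].
Proof.
move=> lRd zB zU zp nkey; have [zR dz] := blankP _ _ _ zB.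
case: (pickP [pred r | [&& r \in R, r != z & e p r]]) => [r|none].
  by case/and3P=> rR rz pr; exists r.
have nonep r : r \in R -> r != z -> e p r -> False.
  by move=> rR rz pr; have:= none r; rewrite /= rR rz pr.
have [optR _ _] := lRd.
have [s [sR zs ds]] := blank_sees true lRd zB.
have [t [tR zt dt]] := blank_sees false lRd zB.
have [p1 zp1 ps] := near_unpaired zR zU sR zs.
have [p2 zp2 pt] := near_unpaired zR zU tR zt.
have sz : s != z by rewrite eq_sym near_neq.
have tz : t != z by rewrite eq_sym near_neq.
have st : s != t by apply: contra_eqN ds => /eqP->; rewrite dt.
have [c cR] := min_bip_proper (optimal_min optR).
have [b [zb key _]] := unpaired_key optR zR cR.
have bp : b != p by apply: contraNneq nkey => <-.
have b1 : b != p1.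
  apply: contraNneq sz => bp1; apply/eqP.
  by apply: (unpaired_key_nbr optR zR zU zb key sR); rewrite bp1.
have b2 : b != p2.
  apply: contraNneq tz => bp2; apply/eqP.
  by apply: (unpaired_key_nbr optR zR zU zb key tR); rewrite bp2.
have p1p : p != p1 by apply/eqP=> pp1; apply: (nonep s); rewrite ?pp1.
have p12 : p1 = p2.
  have [|p2p|//] := nbr_cases zb zp zp1 bp b1 p1p zp2.
    by move=> p2b; rewrite p2b eqxx in b2.
  by case: (nonep t) => //; rewrite -p2p.
case/negP: nkey.
apply: (unpaired_isolated_key optR zp1 zp p1p) => x p1x.
have p1z : e p1 z by rewrite e_sym.
have p1t : e p1 t by rewrite p12.
by have [->|->|->] := nbr_cases p1z ps p1t (near_neq zs) (near_neq zt) st p1x.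
Qed.

(* If p - q joins z to z', neither end is a key, so {p, q} is a component of
   G - R; flipping it provides z with a second key, and then every vertex of R
   near z lies beyond p. *)
Lemma blank_unpaired_far R d z z' p q :
  least_blank R d -> z \in blank R d -> z' \in blank R d ->
  z \notin paired R -> z' \notin paired R -> z != z' ->
  e z p -> e p q -> e q z' -> False.
Proof.
move=> lRd zB zB' zU zU' zz zp pq qz'.
have [zR dz] := blankP _ _ _ zB; have [zR' dz'] := blankP _ _ _ zB'.
have z'q : e z' q by rewrite e_sym.
have pz : e p z by rewrite e_sym.
have qp : e q p by rewrite e_sym.
have pR := unpaired_nbr zR zU zp; have qR := unpaired_nbr zR' zU' z'q.
have notR a b : a \notin R -> b \in R -> a != b.
  by move=> aR bR; apply: contraNneq aR => ->.
have far : ~~ near z z' by apply: (blank_unpaired_near lRd).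
have pkey : ~~ bipartizing (swap R z p).
  apply/negP=> key; have:= blank_key_near lRd zB zU zp key zB'.
  by rewrite eq_sym zz (near_mid (notR _ _ pR zR') pq qz') => /(_ isT).
have qkey : ~~ bipartizing (swap R z' q).
  apply/negP=> key; have:= blank_key_near lRd zB' zU' z'q key zB zz.
  by rewrite (near_mid (notR _ _ qR zR) qp pz).
have [r [rR rz pr]] := blank_nonkey_nbr lRd zB zU zp pkey.
have [r' [rR' rz' qr']] := blank_nonkey_nbr lRd zB' zU' z'q qkey.
have pN x : e p x -> x \notin R -> x = q.
  move=> px xR; rewrite eq_sym in rz.
  have zq : z != q by rewrite eq_sym notR.
  have rq : r != q by rewrite eq_sym notR.
  by have [xE|xE|//] := nbr_cases pz pr pq rz zq rq px; rewrite xE ?zR ?rR in xR.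
have qN x : e q x -> x \notin R -> x = p.
  move=> qx xR; rewrite eq_sym in rz'.
  have zq : z' != p by rewrite eq_sym notR.
  have rq : r' != p by rewrite eq_sym notR.
  by have [xE|xE|//] := nbr_cases qz' qr' qp rz' zq rq qx; rewrite xE ?zR' ?rR' in xR.
have [optR _ _] := lRd.
have [c cR] := min_bip_proper (optimal_min optR).
pose f x := if (x == p) || (x == q) then ~~ c x else c x.
have fR : proper R f.
  move=> x y xR yR xy; rewrite /f.
  have cxy := cR x y xR yR xy.
  have comp a b : e a b -> b \notin R -> (a == p) || (a == q) -> (b == p) || (b == q).
    by move=> ab bR /orP[] /eqP aE; rewrite aE in ab;
       [rewrite (pN b ab bR)|rewrite (qN b ab bR)]; rewrite eqxx ?orbT.
  case: ifP => xpq; case: ifP => ypq //.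
  - by apply: contra cxy => /eqP/negb_inj->.
  - by rewrite (comp x y) in ypq.
  by rewrite (comp y x) // e_sym in xpq.
(* The flip changes no neighbour of [z] except [p]: adjacency to [q] would put [z] near [z']. *)
have fE x : e z x -> x != p -> f x = c x.
  move=> zx xp; rewrite /f (negPf xp) /=; case: eqP => // xq.
  by case/negP: far; apply: (near_mid zz zx); rewrite xq.
have [b [zb bkey bP]] := unpaired_key optR zR cR.
have [b' [zb' bkey' bP']] := unpaired_key optR zR fR.
have bp : b != p by apply: contraNneq pkey => <-.
have bp' : b' != p by apply: contraNneq pkey => <-.
(* Under [c] the colours of [p] and [b] differ; flipping [p] alone makes them agree, so [b] no
   longer has its colour to itself. *)
have bb' : b != b'.
  apply/eqP=> bb'; rewrite -bb' in bP'.
  have pb : p != b by rewrite eq_sym.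
  have:= bP' p zp pb; rewrite (fE b) // /f eqxx /= (bP p zp pb).
  by case: (c b).
have onlyp x : x \in R -> near z x -> e p x.
  move=> xR zx; have [k zk kx] := near_unpaired zR zU xR zx.
  have:= near_neq zx; rewrite eq_sym => /eqP xz.
  have [kE|kE|<-//] := nbr_cases zb zb' zp bb' bp bp' zk.
    by case: xz; apply: (unpaired_key_nbr optR zR zU zb) => //; rewrite -kE.
  by case: xz; apply: (unpaired_key_nbr optR zR zU zb') => //; rewrite -kE.
have [s [sR zs ds]] := blank_sees true lRd zB.
have [t [tR zt dt]] := blank_sees false lRd zB.
have st : s != t by apply: contra_eqN ds => /eqP->; rewrite dt.
(* The neighbours [z], [s], [t] of [p] leave no room for [q], which is outside [R]. *)
have [qE|qE|qE] := nbr_cases pz (onlyp s sR zs) (onlyp t tR zt)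
  (near_neq zs) (near_neq zt) st pq.
- by rewrite qE zR in qR.
- by rewrite qE sR in qR.
by rewrite qE tR in qR.
Qed.

(** * No blank vertex is paired *)

(* Otherwise the blank of z could be moved to x, decreasing the number of paired
   blank vertices. *)
Lemma blank_paired_dup R d z x beta :
  least_blank R d ->
  (forall S f, least_blank S f ->
    #|blank R d :&: paired R| <= #|blank S f :&: paired S|) ->
  z \in blank R d -> z \in paired R -> x \in R -> x \notin paired R ->
  near z x -> d x = Some beta ->
  exists w, [/\ w \in R, near z w, w != x & d w = Some beta].
Proof.
move=> lRd min1 zB zP xR xU zx dx; have [zR dz] := blankP _ _ _ zB.
have [optR dR minR] := lRd.
case: (pickP [pred w | [&& w \in R, near z w, w != x & d w == Some beta]]).
  by move=> w /and4P[wR zw wx /eqP dw]; exists w.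
move=> none; pose f := recolour (recolour d x None) z (Some beta).
have xB : x \notin blank R d by rewrite inE xR dx.
have fB : blank R f = swap (blank R d) z x.
  apply/setP=> w; rewrite in_swap !inE /f /recolour.
  case: (eqVneq w z) => [->|wz] /=; first by rewrite andbF (negPf (near_neq zx)).
  by case: (eqVneq w x) => [->|]; rewrite ?xR.
have fR : valid R f.
  apply: valid_recolour; first exact: valid_recolour.
  move=> w wR zw; rewrite /recolour; case: (eqVneq w x) => // wx dw.
  by have:= none w; rewrite /= wR zw wx dw eqxx.
have lRf : least_blank R f.
  by apply: (least_blank_eq lRd) => //; rewrite fB card_swap.
have:= min1 R f lRf; rewrite fB leqNgt => /negP[].
apply: proper_card; apply/properP; split.
  apply/subsetP=> w; rewrite !in_setI in_swap => /andP[wB wP]; rewrite wP andbT.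
  case/orP: wB => [/eqP wx|/andP[]//].
  by rewrite wx (negPf xU) in wP.
exists z; first by rewrite inE zB zP.
by rewrite inE in_swap eqxx (negPf (near_neq zx)).
Qed.

(** Suppose [z] has partner [y]. Any other coloured vertex near [z] is unpaired, so its colour
    repeats near [z]. As at most two vertices besides [y] are near [z], they share a colour [beta]
    and [y] has the other one. Giving [y] the colour [beta] then frees its old colour for [z]. *)
Lemma blank_unpaired R d z :
  least_blank R d ->
  (forall S f, least_blank S f ->
    #|blank R d :&: paired R| <= #|blank S f :&: paired S|) ->
  z \in blank R d -> z \notin paired R.
Proof.
move=> lRd min1 zB; have [zR dz] := blankP _ _ _ zB.
have [optR dR minR] := lRd.
apply/negP=> zP; have [_ [y yR zy]] := pairedP _ _ zP.
have three := paired_near3 optR zR yR zy.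
have yz : e y z by rewrite e_sym.
have unp x : x \in R -> near z x -> x != y -> x \notin paired R.
  move=> xR zx xy; have [p [zp pR px]] := near_paired optR zR yR zy xR zx xy.
  apply: (paired_nbr_unpaired optR zR yR zy zp) => //.
  by rewrite eq_sym near_neq.
have dup x beta : x \in R -> near z x -> x != y -> d x = Some beta ->
    exists w, [/\ w \in R, near z w, w != x & d w = Some beta].
  by move=> xR zx xy; apply: blank_paired_dup => //; apply: unp.
have dneq a b beta : d a = Some beta -> d b = Some (~~ beta) -> a != b.
  by move=> da db; apply: contra_eqN da => /eqP->; rewrite db; case: (beta).
have [x [beta [xR zx xy dx]]] :
    exists x beta, [/\ x \in R, near z x, x != y & d x = Some beta].
  have [s [sR zs ds]] := blank_sees true lRd zB.
  have [t [tR zt dt]] := blank_sees false lRd zB.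
  case: (eqVneq s y) => [sy|sy]; last by exists s, true.
  by exists t, false; rewrite -sy eq_sym (dneq s t true).
have [t [tR zt dt]] := blank_sees (~~ beta) lRd zB.
have xt := dneq _ _ _ dx dt.
have [w [wR zw wx dw]] := dup x beta xR zx xy dx; rewrite eq_sym in wx.
have wt := dneq _ _ _ dw dt.
(* If [t] were not [y], duplicating colours would give three vertices other than [y] near [z]. *)
have ty : t = y.
  apply/eqP; apply: contraT => ty.
  case: (eqVneq w y) => [wy|wy]; last by case: (three x w t).
  have [u [uR zu ut du]] := dup t (~~ beta) tR zt ty dt; rewrite eq_sym in ut.
  have uw := dneq _ _ _ dw du.
  by case: (three x t u) => //; [rewrite -wy eq_sym|apply: dneq du].
rewrite {t}ty in tR zt dt xt wt.
have [a [za aR ax]] := near_paired optR zR yR zy xR zx xt.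
have [b [zb bR bw]] := near_paired optR zR yR zy wR zw wt.
have xz : x != z by rewrite eq_sym near_neq.
have wz : w != z by rewrite eq_sym near_neq.
have ab : a != b.
  apply: contraNneq wx => ab; apply/eqP.
  by apply: (paired_nbr_unique optR zR yR zy za) => //; rewrite ab.
(* Both neighbours of [z] outside [R] lead to further vertices of [R], so [paired_near] leaves only
   [z] near [y]. *)
have yN v : v \in R -> near y v -> v = z.
  move=> vR yv; apply/eqP; apply: contraT => vz.
  have [a' [ya' a'R a'v]] := near_paired optR yR zR yz vR yv vz.
  case/negP: vz; apply/eqP.
  apply: (paired_near optR zR yR zy za aR zb bR ab ax xR xz xt bw wR wz wt
    ya' a'R a'v vR).
  by rewrite eq_sym near_neq.
pose f := recolour (recolour d y (Some beta)) z (Some (~~ beta)).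
have fR : valid R f.
  apply: valid_recolour.
    by apply: valid_recolour => // v vR /yN -> //; rewrite dz.
  move=> v vR zv; rewrite /recolour; case: (eqVneq v y) => [_ []|vy dv].
    by case: (beta).
  by case: (three x w v) => //; apply: dneq dv.
have:= minR R f optR fR; rewrite leqNgt => /negP[].
apply: proper_card; apply/properP; split.
  apply/subsetP=> v; rewrite !inE /f /recolour.
  by case: (eqVneq v z) => /=; rewrite ?andbF //; case: (eqVneq v y); rewrite ?andbF.
by exists z => //; rewrite inE /f /recolour eqxx andbF.
Qed.

(** * Assembling the packing coloring *)

(** A finite distance is attained by a path, so bounding every walk suffices and repeated vertices
    need no attention. *)
Lemma dist_geqI u v k :
  (forall s, path e u s -> last u s = v -> k <= size s) ->
  dist_geq (dist e u v) k.
Proof.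
move=> h; case E: (dist e u v) => [n|] //=.
have [/existsP[p /and3P[ep /eqP lp _]] _] := (distP e u v n).1 E.
by have:= h p ep lp; rewrite size_tuple.
Qed.

Lemma subcubic_packing :
  exists V : 'I_(size [:: 1; 1; 2; 2; 3]) -> {set T}, packing_coloring e V.
Proof.
have [R [d [lRd min1]]] := least_blank_exists; have [optR dR _] := lRd.
have [c cR] := min_bip_proper (optimal_min optR).
(* Indices 0 and 1 are the bipartition outside [R], 2 and 3 the two colours in [R], and 4 the blank
   vertices. *)
pose f x : 'I_5 := inord (if x \in R then
  match d x with Some true => 2 | Some false => 3 | None => 4 end
  else if c x then 0 else 1).
have fE x : f x = (if x \in R then
    match d x with Some true => 2 | Some false => 3 | None => 4 end
    else if c x then 0 else 1) :> nat.
  by rewrite /f inordK //; case: ifP => _; [case: (d x) => [[]|]|case: (c x)].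
exists (fun i => [set x | f x == i]); split.
  split=> [x|i j ij]; first by exists (f x); rewrite inE.
  apply/pred0P=> x /=; rewrite !inE; apply: contraNF ij.
  by case/andP=> /eqP-> /eqP->.
move=> i u v; rewrite !inE => /eqP <- /eqP/(congr1 val)/= fuv uv.
apply: dist_geqI => p; rewrite fE.
have near1 : path e u p -> last u p = v -> size p <= 2 -> near u v.
  case: p => [|a [|b [|]]] //= => [_ uv' | | ]; first by rewrite uv' eqxx in uv.
    by rewrite andbT => ua av _; apply/nearP; rewrite -av; split; [rewrite av|left].
  by case/and3P=> ua ab _ bv _; apply: (near_mid uv ua); rewrite -bv.
have adj : path e u p -> last u p = v -> size p <= 1 -> e u v.
  case: p {near1} => [|a [|]] //= => [_ uv'|]; first by rewrite uv' eqxx in uv.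
  by rewrite andbT => ua <-.
move: fuv; rewrite !fE.
case: (boolP (u \in R)) => uR; case: (boolP (v \in R)) => vR; last first.
- have cuv := cR u v uR vR.
  move=> cE ep lp; have gt1 : 1 < size p.
    rewrite ltnNge; apply/negP=> /(adj ep lp)/cuv.
    by case: (c u) cE; case: (c v).
  by case: (c u).
- by case: (d v) => [[]|]; case: (c u).
- by case: (d u) => [[]|]; case: (c v).
move=> dE ep lp; have dE' : d u = d v.
  by case: (d u) dE => [[]|]; case: (d v) => [[]|].
case du: (d u) => [beta|].
  have gt2 : 2 < size p.
    rewrite ltnNge; apply/negP=> /(near1 ep lp) nuv.
    by rewrite (dR u v uR vR nuv dE') in du.
  by case: (beta).
have uB : u \in blank R d by apply/blankP.
have vB : v \in blank R d by apply/blankP; rewrite -dE'.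
have uU := blank_unpaired lRd min1 uB; have vU := blank_unpaired lRd min1 vB.
(* Blank vertices need distance at least 4: walks of length at most 2 are excluded by
   [blank_unpaired_near], those of length 3 by [blank_unpaired_far]. *)
rewrite ltnNge /=; apply/negP=> le3.
case: (leqP (size p) 2) => [/(near1 ep lp)|gt2].
  by apply/negP; apply: (blank_unpaired_near lRd).
case: p {near1 adj} ep lp le3 gt2 => [|a [|b [|x [|]]]] //=.
case/and4P=> ua ab bx _ xv _ _; rewrite xv in bx.
exact: (blank_unpaired_far lRd uB vB uU vU uv ua ab bx).
Qed.

End Subcubic.

Theorem theorem1p2 (T : finType) (e : rel T)
    (e_sym : symmetric e) (e_irr : irreflexive e) (e_sub : subcubic e) :
  exists V : 'I_(size [:: 1; 1; 2; 2; 3]) -> {set T},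
    packing_coloring e V.
Proof. exact: subcubic_packing. Qed.
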